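(* Let $\Omega\subset\mathbb{R}^2$ be a polygon. For any real bivariate polynomial $P$ of degree $n\ge 2$, there exist a polynomial $M\in\mathbb{M}(\Omega)$ and a quadratic polynomial $J$ such that $$P(x,y)=M(x,y)+J(x,y),$$ and hence $\int_\Omega P(x,y)\,dx\,dy$ is a linear combination of the values $I_i=\int_\Omega Q_i(x,y)\,dx\,dy$, $i=0,\dots,5$.
   Context: $\mathbb{P}_m$ is the space of real bivariate polynomials of total degree $\le m$. A polygon is a bounded polygonal domain in $\mathbb{R}^2$ with positive area. For each $m\ge 1$, $P_{m,0},\dots,P_{m,m}$ is an orthogonal basis, with respect to the inner product $\int_\Omega fg\,dx\,dy$, of $\mathbb{P}_m\ominus\mathbb{P}_{m-1}$, the orthogonal complement of $\mathbb{P}_{m-1}$ in $\mathbb{P}_m$. Define $$\mathbb{M}(\Omega)=\Big\{\sum_{k=1}^{d'}\sum_{j=0}^{2k-1}q_{k,j}(x,y)P_{2k-1,j}(x,y)+R :\ q_{k,j}\text{ polynomials of degree}\le 2k-2 \text{ for all } j=0,\dots,2k-1,\ R \text{ a constant},\ d'\ge 2\Big\}.$$ ''Quadratic polynomial'' means a real bivariate polynomial of total degree at most $2$, and $Q_0,\dots,Q_5$ are the six monomials $1,x,y,x^2,xy,y^2$ of degree at most $2$. *)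

(* Defs.v *)
From HB Require Import structures.
From mathcomp Require Import all_boot all_order all_algebra.
(* The notations of mpoly clash with those of mathcomp-analysis. *)
From mathcomp Require Import -(notations) mpoly.
From mathcomp Require Import all_classical all_reals all_analysis.
Import Order.TTheory GRing.Theory Num.Theory.
Import numFieldNormedType.Exports.

Set Implicit Arguments.
Unset Strict Implicit.
Unset Printing Implicit Defensive.

Local Open Scope classical_set_scope.
Local Open Scope ring_scope.

Section Defs.
Variable R : realType.
Implicit Types (Omega : set (R * R)) (f g p : mpoly 2 R).

Definition segment_between (a b : R * R) : set (R * R) :=
  [set ((1 - t) * a.1 + t * b.1, (1 - t) * a.2 + t * b.2) | t in `[0, 1]].

Local Notation mu2 := (@lebesgue_measure R \x @lebesgue_measure R)%E.

(* A bounded domain of positive area whose boundary is a finite union of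
   nondegenerate closed segments; holes and slits are allowed. *)
Definition polygon Omega : Prop :=
  [/\ open Omega,
      connected Omega,
      bounded_set Omega,
      (exists2 s : seq ((R * R) * (R * R)),
         forall e, e \in s -> e.1 != e.2 &
         closure Omega `\` interior Omega =
           \bigcup_(e in [set` s]) segment_between e.1 e.2) &
      (0 < mu2 Omega)%E].

Definition poly_eval p (z : R * R) : R :=
  meval (fun i : 'I_2 => if i == ord0 then z.1 else z.2) p.

(* [msize p] is 1 + the total degree of [p] (and 0 for p = 0). *)
Definition degree_le (m : nat) p : Prop := (msize p <= m.+1)%N.

Definition polyint Omega p : R :=
  \int[mu2]_(z in Omega) poly_eval p z.

Definition inner Omega f g : R :=
  \int[mu2]_(z in Omega)
    (poly_eval f z * poly_eval g z).

(* The orthogonal complement of P_(m-1) in P_m, for m >= 1. *)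
Definition ortho_complement Omega (m : nat) : set (mpoly 2 R) :=
  [set f | degree_le m f /\
           forall g, degree_le m.-1 g -> inner Omega f g = 0].

Definition orthogonal_basis Omega (m : nat) (b : 'I_m.+1 -> mpoly 2 R) : Prop :=
  [/\ forall j, ortho_complement Omega m (b j),
      forall i j, i != j -> inner Omega (b i) (b j) = 0,
      forall c : 'I_m.+1 -> R, \sum_j c j *: b j = 0 -> forall j, c j = 0 &
      forall f, ortho_complement Omega m f ->
        exists c : 'I_m.+1 -> R, f = \sum_j c j *: b j].

(* The set M(Omega) built from the basis polynomials P m j; the dependence on
   Omega is through the family P. *)
Definition Mspace (P : forall m : nat, 'I_m.+1 -> mpoly 2 R) :
    set (mpoly 2 R) :=
  [set M | exists (d' : nat)
             (q : forall k : nat, 'I_(2 * k - 1).+1 -> mpoly 2 R) (c : R),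
     [/\ (2 <= d')%N,
         forall k, (1 <= k <= d')%N -> forall j, degree_le (2 * k - 2) (q k j) &
         M = \sum_(1 <= k < d'.+1)
               \sum_(j < (2 * k - 1).+1) q k j * P (2 * k - 1)%N j
             + mpolyC 2 c]].

Definition Q : 'I_6 -> mpoly 2 R :=
  let x : mpoly 2 R := mpolyX R (mnm1 (0 : 'I_2)) in
  let y : mpoly 2 R := mpolyX R (mnm1 (1 : 'I_2)) in
  tnth [tuple 1; x; y; x ^+ 2; x * y; y ^+ 2].

End Defs.

(* Main.v *)
Require Import Defs.
From HB Require Import structures.
From mathcomp Require Import all_boot all_order all_algebra.
From mathcomp Require Import zify.
From mathcomp Require Import -(notations) mpoly.
From mathcomp Require Import all_classical all_reals all_analysis.
From mathcomp Require Import measurable_realfun.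
Import Order.TTheory GRing.Theory Num.Theory.
Import numFieldNormedType.Exports.

Set Implicit Arguments.
Unset Strict Implicit.
Unset Printing Implicit Defensive.

Local Open Scope classical_set_scope.
Local Open Scope ring_scope.

(** The heart of the matter is that the leading forms of [P m 0], ..., [P m m]
    span all forms of degree [m]. If a combination of the [P m j] had degree
    less than [m], it would be orthogonal to itself, since all the [P m j] are
    orthogonal to lower degrees; the inner product is definite, so that
    combination vanishes, and with it all its coefficients. Hence the [m + 1]
    leading forms are linearly independent, and [m + 1] is the dimension of the
    space of forms of degree [m] in two variables ([leading_forms_span]).

    A monomial of degree [m + d] is the product of a monomial of degree [d] and
    one of degree [m], so every polynomial of degree at most [m + d] drops
    below that degree after subtraction of some [\sum_j q j * P m j] with all
    [q j] of degree at most [d] ([leading_division]). For a degree [N >= 3], the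
    largest odd [m = 2 k - 1 <= N] leaves [d <= 1 <= 2 k - 2], which is exactly
    what M(Omega) allows; the induction on the degree ends at a quadratic
    polynomial ([odd_degree_division]). In degree [2] the scheme stops, because
    there [m = 1] only allows constant [q].

    The integral of [q * P (2 k - 1) j] is an inner product with a polynomial
    of lower degree than [2 k - 1], hence zero: only the quadratic remainder
    contributes to the integral.

    The analytic input is linearity and definiteness of the inner product.
    Polynomials are bounded on a bounded set, hence integrable on Omega. If the
    integral of [f ^ 2] is zero then the open set where [f] differs from zero
    is negligible, hence empty, as a nonempty open set contains a box of
    positive area; and a polynomial vanishing on a box is zero. *)

(** * Bivariate polynomials and their degrees *)

(** Reduces any assertion that is stable under linear combinations to
    monomials. *)
Lemma msize_le_ind (n : nat) (F : nzRingType) (N : nat) (K : mpoly n F -> Prop) :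
  K 0 -> (forall p q, K p -> K q -> K (p + q)) ->
  (forall c p, K p -> K (c *: p)) ->
  (forall m, (mdeg m < N)%N -> K (mpolyX F m)) ->
  forall p, (msize p <= N)%N -> K p.
Proof.
move=> K0 KD KZ KX p pN; rewrite (mpolyE p) big_seq.
apply: big_ind => // m mp; apply: KZ; apply: KX.
exact: leq_trans (msize_mdeg_lt mp) pN.
Qed.

Lemma msizeD_le (n : nat) (F : nzRingType) (N : nat) (p q : mpoly n F) :
  (msize p <= N)%N -> (msize q <= N)%N -> (msize (p + q) <= N)%N.
Proof.
by move=> pN qN; rewrite (leq_trans (mmeasureD_le _ _ _))// geq_max pN.
Qed.

Lemma msize_sum_le (n : nat) (F : nzRingType) (N : nat) (I : Type) (r : seq I)
    (f : I -> mpoly n F) :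
  (forall i, (msize (f i) <= N)%N) -> (msize (\sum_(i <- r) f i) <= N)%N.
Proof.
move=> fN; apply: (big_ind (fun p => (msize p <= N)%N)) => //.
  by rewrite mmeasure0.
exact: msizeD_le.
Qed.

Lemma msize_le_pred (n : nat) (F : nzRingType) (N : nat) (p : mpoly n F) :
  (msize p <= N.+1)%N -> (forall m, mdeg m = N -> mcoeff m p = 0) ->
  (msize p <= N)%N.
Proof.
move=> pN p0; rewrite msizeE; apply/bigmax_leqP_seq => m mp _.
rewrite ltn_neqAle -ltnS (leq_trans (msize_mdeg_lt mp) pN) andbT.
by apply/negP => /eqP/p0/eqP; rewrite mcoeff_eq0 mp.
Qed.

Definition mnm2 (a b : nat) : multinom 2 := Multinom [tuple a; b].

Lemma mnm2E (m : multinom 2) : m = mnm2 (m ord0) (m ord_max).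
Proof.
apply/mnmP => i; have [->|->] : i = ord0 \/ i = ord_max.
- by case: i => [[|[|//]] ?]; [left|right]; apply/val_inj.
- by rewrite [RHS]mnm_tnth.
- by rewrite [RHS]mnm_tnth.
Qed.

Lemma mnm2_eq a b c d : (mnm2 a b == mnm2 c d) = (a == c) && (b == d).
Proof.
apply/eqP/andP => [E|[/eqP-> /eqP->]]//.
have := congr1 (fun m : multinom 2 => m ord0) E.
have := congr1 (fun m : multinom 2 => m ord_max) E.
by rewrite !mnm_tnth !(tnth_nth 0%N) /= => -> ->.
Qed.

Lemma mdeg2 (m : multinom 2) : mdeg m = (m ord0 + m ord_max)%N.
Proof.
rewrite mdegE big_ord_recl big_ord1; congr (_ + m _)%N.
exact/val_inj.
Qed.

Lemma mdeg_mnm2 a b : mdeg (mnm2 a b) = (a + b)%N.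
Proof. by rewrite mdeg2 !mnm_tnth. Qed.

(** * Division by a family of independent leading forms *)

(** In two variables there are as many monomials of degree [m] as members of
    [b], so the square matrix of the top coefficients of [b] is invertible as
    soon as its rows are independent; its inverse solves for the combination
    with the same leading form as [f]. *)
Lemma leading_forms_span (F : fieldType) (m : nat) (b : 'I_m.+1 -> mpoly 2 F) :
  (forall j, (msize (b j) <= m.+1)%N) ->
  (forall c : 'I_m.+1 -> F,
     (msize (\sum_j c j *: b j) <= m)%N -> forall j, c j = 0) ->
  forall f, (msize f <= m.+1)%N ->
    exists c : 'I_m.+1 -> F, (msize (f - \sum_j c j *: b j) <= m)%N.
Proof.
move=> bm bfree f fm.
(* These are all the monomials of degree m. *)
pose mono (i : 'I_m.+1) := mnm2 i (m - i).
have top (g : mpoly 2 F) : (msize g <= m.+1)%N ->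
    (forall i, mcoeff (mono i) g = 0) -> (msize g <= m)%N.
  move=> gm g0; apply: msize_le_pred => // mu mum.
  have mu0 : (mu ord0 < m.+1)%N by rewrite ltnS -mum mdeg2 leq_addr.
  rewrite -(g0 (Ordinal mu0)); congr (mcoeff _ _).
  by rewrite [LHS]mnm2E /mono/= -mum mdeg2 addKn.
have summ (c : 'I_m.+1 -> F) : (msize (\sum_j c j *: b j) <= m.+1)%N.
  by apply: msize_sum_le => j; rewrite (leq_trans (msizeZ_le _ _)).
have coef (c : 'I_m.+1 -> F) i :
    mcoeff (mono i) (\sum_j c j *: b j) = \sum_j c j * mcoeff (mono i) (b j).
  by rewrite raddf_sum; apply: eq_bigr => j _; rewrite /= mcoeffZ.
pose A := \matrix_(j, i) mcoeff (mono i) (b j).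
have : row_free A.
  rewrite -kermx_eq0; apply/eqP/row_matrixP => k.
  set u := row k (kermx A).
  have uA : u *m A = 0 by rewrite /u -row_mul mulmx_ker row0.
  rewrite row0; apply/rowP => j; rewrite [RHS]mxE.
  apply: (bfree (u ord0)); apply: top => // i.
  rewrite coef; transitivity ((u *m A) ord0 i); last by rewrite uA mxE.
  by rewrite mxE; apply: eq_bigr => l _; rewrite [A _ _]mxE.
rewrite row_free_unit => Au.
pose v := \row_i mcoeff (mono i) f.
exists ((v *m invmx A) ord0); apply: top.
  by rewrite msizeD_le// mmeasureN.
move=> i; rewrite mcoeffB coef.
have -> : mcoeff (mono i) f = v ord0 i by rewrite mxE.
apply/eqP; rewrite subr_eq0 -{1}(mulmxKV Au v) [X in X == _]mxE; apply/eqP.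
by apply: eq_bigr => j _; rewrite [A _ _]mxE.
Qed.

(** By linearity [f] may be taken to be a monomial of degree [m + d]; it splits
    as a monomial of degree [d] times one of degree [m], and the latter is a
    combination of [b] up to lower degree. *)
Lemma leading_division (F : fieldType) (m d : nat) (b : 'I_m.+1 -> mpoly 2 F) :
  (forall j, (msize (b j) <= m.+1)%N) ->
  (forall f, (msize f <= m.+1)%N ->
    exists c : 'I_m.+1 -> F, (msize (f - \sum_j c j *: b j) <= m)%N) ->
  forall f, (msize f <= (m + d).+1)%N ->
    exists q : 'I_m.+1 -> mpoly 2 F,
      (forall j, (msize (q j) <= d.+1)%N) /\
      (msize (f - \sum_j q j * b j) <= m + d)%N.
Proof.
move=> bm bspan; apply: msize_le_ind.
- exists (fun=> 0); split=> [j|]; first by rewrite mmeasure0.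
  by rewrite big1 ?subr0 ?mmeasure0// => j _; rewrite mul0r.
- move=> f g [q [qd fq]] [r [rd gr]]; exists (fun j => q j + r j).
  split=> [j|]; first exact: msizeD_le.
  under eq_bigr do rewrite mulrDl.
  by rewrite big_split opprD addrACA; exact: msizeD_le.
- move=> c f [q [qd fq]]; exists (fun j => c *: q j).
  split=> [j|]; first by rewrite (leq_trans (msizeZ_le _ _)).
  under eq_bigr do rewrite -scalerAl.
  by rewrite -scaler_sumr -scalerBr (leq_trans (msizeZ_le _ _)).
move=> mu; rewrite ltnS leq_eqVlt => /predU1P[muE|mu_lt]; last first.
  exists (fun=> 0); split=> [j|]; first by rewrite mmeasure0.
  by rewrite big1 ?subr0 ?msizeX// => j _; rewrite mul0r.
(* lo is a divisor of mu of degree m: take as many factors of the first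
   variable as possible. *)
pose a := minn (mu ord0) m.
pose lo := mnm2 a (m - a); pose hi := mnm2 (mu ord0 - a) (mu ord_max - (m - a)).
have am : (a <= m)%N by exact: geq_minr.
have mu_split : mu = mnm_add hi lo.
  rewrite [LHS]mnm2E [RHS]mnm2E !mnmDE !mnm_tnth; congr mnm2 => /=.
    by rewrite subnK// geq_minl.
  rewrite subnK//; move: muE; rewrite mdeg2.
  by rewrite /a /minn; case: ltnP => ? ?; lia.
have degS : (mdeg hi + mdeg lo = m + d)%N by rewrite -mdegD -mu_split.
have lom : mdeg lo = m by rewrite mdeg_mnm2 subnKC.
have hid : mdeg hi = d by lia.
have [|c cm] := bspan (mpolyX F lo); first by rewrite msizeX lom.
exists (fun j => c j *: mpolyX F hi); split=> [j|].
  by rewrite (leq_trans (msizeZ_le _ _))// msizeX hid.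
under eq_bigr do rewrite -scalerAl scalerAr.
rewrite -mulr_sumr mu_split mpolyXD -mulrBr.
have [->|g0] := eqVneq (mpolyX F lo - \sum_j c j *: b j) 0.
  by rewrite mulr0 mmeasure0.
rewrite msizeM//; last by rewrite -(mmeasure_poly_eq0 mdeg) msizeX.
by rewrite msizeX hid addSn /= addnC leq_add2r.
Qed.

(** Induction on a bound [N] for the degree of [p]. The number [n] of terms is kept fixed, so
    that the contributions of the successive steps simply add up. *)
Lemma odd_degree_division (F : fieldType)
    (P : forall m : nat, 'I_m.+1 -> mpoly 2 F) :
  (forall m j, (1 <= m)%N -> (msize (P m j) <= m.+1)%N) ->
  (forall m f, (1 <= m)%N -> (msize f <= m.+1)%N ->
    exists c : 'I_m.+1 -> F, (msize (f - \sum_j c j *: P m j) <= m)%N) ->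
  forall n N p, (N <= n)%N -> (msize p <= N.+1)%N ->
  exists q : forall k : nat, 'I_(2 * k - 1).+1 -> mpoly 2 F,
    (forall k j, (msize (q k j) <= (2 * k - 2).+1)%N) /\
    (msize (p - \sum_(1 <= k < n.+1) \sum_(j < (2 * k - 1).+1)
              q k j * P (2 * k - 1)%N j)%R <= 3)%N.
Proof.
move=> Pm Pspan n; elim=> [|N IH] p Nn pN;
  (have [p3|p3] := leqP (msize p) 3;
    first by exists (fun _ _ => 0); split=> [k j|];
      [rewrite mmeasure0 | rewrite big1 ?subr0// => k _; rewrite big1// => j _;
        rewrite mul0r]).
  by have := leq_trans p3 pN.
have N2 : (1 < N)%N := leq_trans p3 pN.
(* 2 k0 - 1 is the largest odd number at most N.+1, so the complementary
   degree d is 0 or 1; it is at most 2 k0 - 2 because k0 >= 2. *)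
pose k0 := (N.+2)./2.
have k0E : (2 * k0 = N.+2 - odd N)%N.
  by rewrite mul2n -[X in (X - _)%N]odd_double_half /= negbK addKn.
have Nb : (odd N <= 1)%N by case: (odd N).
have k01 : (1 <= 2 * k0 - 1)%N by lia.
pose d := (N.+1 - (2 * k0 - 1))%N.
have md : (2 * k0 - 1 + d = N.+1)%N by lia.
have k02 : (2 <= k0)%N by lia.
have := @leading_division F (2 * k0 - 1) d (P (2 * k0 - 1)%N).
move=> /(_ (fun j => Pm _ j k01) (fun f => Pspan _ f k01) p).
rewrite md => /(_ pN)[q0 [q0d q0p]].
have [q1 [q1d q1p]] := IH _ (ltnW Nn) q0p.
(* The index types of q1 k and q0 agree only propositionally when k = k0, so
   the index j is transported by inord. *)
exists (fun k j => q1 k j + (if k == k0 then q0 (inord j) else 0)); split.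
  move=> k j; apply: msizeD_le => //; case: eqP => [kE|_].
    by apply: leq_trans (q0d _) _; lia.
  by rewrite mmeasure0.
suff -> : \sum_(1 <= k < n.+1) \sum_(j < (2 * k - 1).+1)
      (q1 k j + (if k == k0 then q0 (inord j) else 0)) * P (2 * k - 1)%N j =
    \sum_(j < (2 * k0 - 1).+1) q0 j * P (2 * k0 - 1)%N j +
    \sum_(1 <= k < n.+1) \sum_(j < (2 * k - 1).+1)
      q1 k j * P (2 * k - 1)%N j.
  by rewrite opprD addrA.
rewrite addrC.
under eq_bigr do under eq_bigr do rewrite mulrDl.
under eq_bigr do rewrite big_split/=.
rewrite big_split/=; congr (_ + _).
rewrite (bigD1_seq k0) ?iota_uniq ?mem_index_iota//=; last by lia.
rewrite eqxx [X in _ + X]big1 ?addr0.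
  by apply: eq_bigr => j _; rewrite inord_val.
by move=> k /negPf ->; rewrite big1// => j _; rewrite mul0r.
Qed.

Lemma quadratic_span (R : realType) (J : mpoly 2 R) : (msize J <= 3)%N ->
  exists c : 'I_6 -> R, J = \sum_i c i *: Q R i.
Proof.
move: J; apply: msize_le_ind.
- by exists (fun=> 0); rewrite big1// => i _; rewrite scale0r.
- move=> p q [c ->] [d ->]; exists (fun i => c i + d i).
  by rewrite -big_split; apply: eq_bigr => i _; rewrite scalerDl.
- move=> a p [c ->]; exists (fun i => a * c i).
  by rewrite scaler_sumr; apply: eq_bigr => i _; rewrite scalerA.
move=> m m2; suff [i ->] : exists i, mpolyX R m = Q R i.
  exists (fun j => (j == i)%:R); rewrite (bigD1 i)//= eqxx scale1r big1 ?addr0//.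
  by move=> j /negPf ->; rewrite scale0r.
rewrite mpolyXE_id big_ord_recl big_ord1; move: m2; rewrite mdeg2.
rewrite (_ : lift ord0 ord0 = ord_max :> 'I_2); last exact/val_inj.
move: (m ord0) (m ord_max) => [|[|[|a]]] [|[|[|b]]] // _.
- by exists (inord 0); rewrite /Q (tnth_nth 0) inordK// !expr0 mulr1.
- by exists (inord 2); rewrite /Q (tnth_nth 0) inordK// expr0 mul1r.
- by exists (inord 5); rewrite /Q (tnth_nth 0) inordK// expr0 mul1r.
- by exists (inord 1); rewrite /Q (tnth_nth 0) inordK// expr0 mulr1.
- by exists (inord 4); rewrite /Q (tnth_nth 0) inordK//.
- by exists (inord 3); rewrite /Q (tnth_nth 0) inordK// expr0 mulr1.
Qed.

(** * Polynomials that vanish on a box *)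

Lemma poly_ball_eq0 (R : realType) (c r : R) (p : {poly R}) : 0 < r ->
  (forall x, ball c r x -> p.[x] = 0) -> p = 0.
Proof.
move=> r0 p0.
pose pt i := c + r / i.+2%:R.
apply: (@roots_geq_poly_eq0 _ p [seq pt i | i <- iota 0 (size p)]).
- apply/allP => _ /mapP[i _ ->]; apply/rootP/p0.
  rewrite /ball/= /pt opprD addNKr normrN gtr0_norm ?divr_gt0//.
  by rewrite ltr_pdivrMr// ltr_pMr// ltr1n.
- rewrite map_inj_uniq ?iota_uniq// => i j /addrI /(mulfI (lt0r_neq0 r0)).
  by move=> /invr_inj /eqP; rewrite eqr_nat => /eqP[].
- by rewrite size_map size_iota.
Qed.

(** Seen as a polynomial in the second variable, [p] has as coefficients
    polynomials in the first one. For a fixed first coordinate it has infinitely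
    many roots, so all these coefficients vanish there; each of them then has
    infinitely many roots in turn. *)
Lemma poly_eval_box_eq0 (R : realType) (z : R * R) (r : R) (p : mpoly 2 R) :
  0 < r ->
  (forall w, (ball z.1 r `*` ball z.2 r) w -> poly_eval p w = 0) -> p = 0.
Proof.
move=> r0 p0.
pose B : {poly {poly R}} := \sum_(m <- msupp p)
  (mcoeff m p *: 'X^(m ord0)) *: 'X^(m ord_max).
have Beval x y : (map_poly (horner_eval x) B).[y] = poly_eval p (x, y).
  rewrite /B rmorph_sum horner_sum /poly_eval mevalE; apply: eq_bigr => m _ /=.
  rewrite map_polyZ map_polyXn hornerZ hornerXn /= /horner_eval hornerZ hornerXn.
  rewrite big_ord_recl big_ord1 mulrA/=; congr (_ * _ * y ^+ m _).
  exact/val_inj.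
have Bcoef i j : B`_j`_i = mcoeff (mnm2 i j) p.
  rewrite [in RHS](mpolyE p) /B !coef_sum raddf_sum; apply: eq_bigr => m _ /=.
  have -> : mcoeff (mnm2 i j) (mcoeff m p *: mpolyX R m) =
      mcoeff m p * ((i == m ord0) && (j == m ord_max))%:R.
    by rewrite mcoeffZ mcoeffX {2}(mnm2E m) eq_sym mnm2_eq.
  rewrite coefZ coefXn; case: eqP => _; last by rewrite mulr0 andbF coef0 mulr0.
  by rewrite mulr1 coefZ coefXn andbT.
suff B0 : B = 0.
  by apply/mpolyP => m; rewrite (mnm2E m) -Bcoef B0 !coef0 mcoeff0.
apply/polyP => j; rewrite coef0; apply: (@poly_ball_eq0 R z.1 r) => // x zx.
have : map_poly (horner_eval x) B = 0.
  by apply: (@poly_ball_eq0 R z.2 r) => // y zy; rewrite Beval; exact: p0.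
by move=> /(congr1 (fun q : {poly R} => q`_j)); rewrite /= coef_map coef0.
Qed.

(** * Polynomial functions on the plane *)

(** Every property of functions that passes to sums and products holds for
    polynomial functions once it holds for constants and coordinates; this
    serves for continuity, measurability and boundedness alike. *)
Lemma poly_eval_ind (R : realType) (K : (R * R -> R) -> Prop) :
  (forall c, K (cst c)) -> K fst -> K snd ->
  (forall f g, K f -> K g -> K (fun z => f z + g z)) ->
  (forall f g, K f -> K g -> K (fun z => f z * g z)) ->
  forall p, K (poly_eval p).
Proof.
move=> Kc K1 K2 KD KM p.
have Ksum (I : Type) (r : seq I) (F : I -> R * R -> R) :
    (forall i, K (F i)) -> K (fun z => \sum_(i <- r) F i z).
  move=> KF; elim: r => [|i r IH].
    by rewrite (_ : (fun _ => _) = cst 0)//; apply/funext => z; rewrite big_nil.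
  under eq_fun do rewrite big_cons.
  exact: KD.
have KX (f : R * R -> R) k : K f -> K (fun z => f z ^+ k).
  move=> Kf; elim: k => [|k IH].
    by rewrite (_ : (fun _ => _) = cst 1)//; apply/funext => z; rewrite expr0.
  under eq_fun do rewrite exprS.
  exact: KM.
rewrite (_ : poly_eval p = fun z => \sum_(m <- msupp p)
    mcoeff m p * (z.1 ^+ m ord0 * z.2 ^+ m (lift ord0 ord0))).
  by apply: Ksum => m; exact: (KM _ _ (Kc _) (KM _ _ (KX _ _ K1) (KX _ _ K2))).
apply/funext => z; rewrite /poly_eval mevalE; apply: eq_bigr => m _.
by rewrite big_ord_recl big_ord1.
Qed.

Lemma poly_evalD (R : realType) (p q : mpoly 2 R) z :
  poly_eval (p + q) z = poly_eval p z + poly_eval q z.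
Proof. exact: mevalD. Qed.

Lemma poly_evalM (R : realType) (p q : mpoly 2 R) z :
  poly_eval (p * q) z = poly_eval p z * poly_eval q z.
Proof. exact: mevalM. Qed.

Lemma poly_evalZ (R : realType) c (p : mpoly 2 R) z :
  poly_eval (c *: p) z = c * poly_eval p z.
Proof. exact: mevalZ. Qed.

Lemma continuous_poly_eval (R : realType) (p : mpoly 2 R) :
  continuous (poly_eval p).
Proof.
apply: (@poly_eval_ind R (fun f => continuous f)).
- by move=> c x; exact: cvg_cst.
- by move=> x; exact: cvg_fst.
- by move=> x; exact: cvg_snd.
- by move=> f g cf cg x; apply: cvgD; [exact: cf|exact: cg].
- by move=> f g cf cg x; apply: cvgM; [exact: cf|exact: cg].
Qed.

Lemma measurable_poly_eval (R : realType) (p : mpoly 2 R) (D : set (R * R)) :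
  measurable_fun D (poly_eval p).
Proof.
apply: measurable_funTS; move: p.
apply: (@poly_eval_ind R (fun f => measurable_fun setT f)).
- by move=> c; exact: measurable_cst.
- exact: measurable_fst.
- exact: measurable_snd.
- by move=> f g cf cg; exact: measurable_funD.
- by move=> f g cf cg; exact: measurable_funM.
Qed.

Lemma bounded_poly_eval (R : realType) (p : mpoly 2 R) (D : set (R * R)) :
  bounded_set D -> exists B, forall z, D z -> `|poly_eval p z| <= B.
Proof.
move=> [M [Mr DM]]; have {Mr}DM1 z : D z -> `|z| <= M + 1.
  by move=> Dz; apply: DM => //; rewrite ltrDl.
move: p.
apply: (@poly_eval_ind R (fun f => exists B, forall z, D z -> `|f z| <= B)).
- by move=> c; exists `|c|.
- exists (M + 1) => z /DM1; apply: le_trans.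
  by rewrite [leRHS]prod_normE le_max lexx.
- exists (M + 1) => z /DM1; apply: le_trans.
  by rewrite [leRHS]prod_normE le_max lexx orbT.
- move=> f g [A fA] [B gB]; exists (A + B) => z Dz.
  by rewrite (le_trans (ler_normD _ _))// lerD ?fA ?gB.
- move=> f g [A fA] [B gB]; exists (A * B) => z Dz.
  by rewrite normrM ler_pM ?fA ?gB.
Qed.

(** * Area of plane sets *)

Lemma open_box (R : realType) (A : set (R * R)) z : open A -> A z ->
  exists2 r : R, 0 < r & ball z.1 r `*` ball z.2 r `<=` A.
Proof.
move=> oA Az; have /nbhs_ballP[r /= r0 rA] : nbhs z A by exact: open_nbhs_nbhs.
by exists r => // w [w1 w2]; apply: rA.
Qed.

(** The product sigma-algebra is generated by rectangles, so an open set is to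
    be written as a countable union of these: take the squares with rational
    centre and radius that it contains. *)
Lemma open_measurable_plane (R : realType) (A : set (R * R)) :
  open A -> measurable A.
Proof.
move=> oA.
pose B (i : rat * rat * rat) : set (R * R) :=
  ball (ratr i.1.1 : R) (ratr i.2) `*` ball (ratr i.1.2 : R) (ratr i.2).
pose F i := if `[< B i `<=` A >] then B i else set0.
rewrite (_ : A = \bigcup_i F i); last first.
  apply/seteqP; split=> [z Az|z [i _]]; last first.
    by rewrite /F; case: asboolP => // BA /BA.
  have [r r0 rA] := open_box oA Az.
  (* A square of radius s < r / 2 whose centre is within s of z contains z and
     stays within 2 s < r of it. *)
  have [s] := rat_in_itvoo (divr_gt0 r0 (ltr0n _ 2)).
  rewrite in_itv/= => /andP[s0 sr].
  have near (x : R) : exists q : rat, `|ratr q - x| < ratr s.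
    have [|q] := @rat_in_itvoo R (x - ratr s) (x + ratr s).
      by rewrite ltrBlDr -addrA ltrDl addr_gt0.
    by rewrite in_itv/= -ltr_distl => ?; exists q.
  have [a az] := near z.1; have [b bz] := near z.2.
  have za : ball (ratr a : R) (ratr s) z.1 by [].
  have zb : ball (ratr b : R) (ratr s) z.2 by [].
  exists (a, b, s) => //; rewrite /F; case: asboolP => // -[] w [/= wa wb].
  have r2 : ratr s + ratr s < r by rewrite [ltRHS]splitr ltrD.
  apply: rA; split; apply: (le_ball (ltW r2)).
    exact: ball_triangle (ball_sym za) wa.
  exact: ball_triangle (ball_sym zb) wb.
apply: countable_bigcupT_measurable => [|i]; first exact: countableP.
rewrite /F; case: asboolP => _; last exact: measurable0.
by apply: measurableX; exact: measurable_ball.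
Qed.

Section plane_measure.
Variable R : realType.
Local Notation mu2 := (@lebesgue_measure R \x @lebesgue_measure R)%E.

Lemma box_measure (z : R * R) (r : R) : 0 <= r ->
  mu2 (ball z.1 r `*` ball z.2 r) = (r *+ 2 * (r *+ 2))%:E.
Proof.
move=> r0; rewrite product_measure1E; [|exact: measurable_ball..].
by rewrite EFinM; congr (_ * _)%E; exact: lebesgue_measure_ball.
Qed.

Lemma bounded_measure_fin (D : set (R * R)) : measurable D -> bounded_set D ->
  (mu2 D < +oo)%E.
Proof.
move=> mD [M [_ DM]].
set r := `|M| + 2.
have r0 : 0 <= r by rewrite addr_ge0.
have Dr : D `<=` ball (0 : R) r `*` ball (0 : R) r.
  move=> z Dz; have /= zM : `|z| <= `|M| + 1.
    by apply: DM => //; rewrite ltr_pwDr ?ler_norm.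
  have : `|z| < r by rewrite (le_lt_trans zM)// ltrD2l ltr1n.
  rewrite [ltLHS]prod_normE gt_max => /andP[z1 z2].
  by split; rewrite /ball/= sub0r normrN.
apply: le_lt_trans (ltry (r *+ 2 * (r *+ 2))).
rewrite -(@box_measure (0 : R, 0 : R))//; apply: le_measure => //; rewrite inE//.
by apply: measurableX; exact: measurable_ball.
Qed.

Lemma integrable_poly_eval (D : set (R * R)) p : measurable D ->
  bounded_set D -> mu2.-integrable D (EFin \o poly_eval p).
Proof.
move=> mD bD; apply: measurable_bounded_integrable => //.
- exact: bounded_measure_fin.
- exact: measurable_poly_eval.
have [B pB] := bounded_poly_eval p bD.
exists B; split; first exact: num_real.
by move=> x Bx z Dz; exact: le_trans (pB _ Dz) (ltW Bx).
Qed.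

(** A nonnegative function of zero integral vanishes almost everywhere; here
    its nonzero set is open, and a nonempty open set is not negligible since it
    contains a box. *)
Lemma Rintegral_sqr_eq0 (D : set (R * R)) p :
  open D -> bounded_set D ->
  \int[mu2]_(z in D) (poly_eval p z * poly_eval p z) = 0 ->
  forall z, D z -> poly_eval p z = 0.
Proof.
move=> oD bD int0 z Dz; apply/eqP/negP => /negP pz0.
have mD := open_measurable_plane oD.
pose N := D `&` [set z | poly_eval p z != 0].
have oN : open N.
  apply: openI => //.
  rewrite (_ : [set _ | _] = poly_eval p @^-1` (~` [set 0])); last first.
    by apply/seteqP; split => w /= /eqP.
  apply: open_comp; first by move=> w _; exact: continuous_poly_eval.
  exact: closed_openC.
have [r r0 rN] := open_box oN (conj Dz pz0).
have intpp : mu2.-integrable D (EFin \o poly_eval (p * p)).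
  exact: integrable_poly_eval.
have : ae_eq mu2 D (EFin \o poly_eval (p * p)) (cst 0%E).
  apply/ae_eq_integral_abs => //.
    by apply/measurable_EFinP; exact: measurable_poly_eval.
  under eq_integral => w _.
    rewrite /= ger0_norm; last by rewrite poly_evalM -expr2 sqr_ge0.
    over.
  rewrite -(fineK (integrable_fin_num _ intpp))//; congr EFin.
  by rewrite -[RHS]int0; apply: eq_Rintegral => w _; rewrite poly_evalM.
move=> [U [mU U0 NU]].
have : (mu2 (ball z.1 r `*` ball z.2 r) <= mu2 U)%E.
  apply: le_measure; rewrite ?inE//.
    by apply: measurableX; exact: measurable_ball.
  move=> w /rN [Dw pw0]; apply: NU => /(_ Dw) /= [] /eqP.
  by rewrite poly_evalM mulf_eq0 orbb; exact/negP.
rewrite U0 box_measure ?(ltW r0)// lee_fin; apply/negP.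
by rewrite -ltNge mulr_gt0// mulrn_wgt0.
Qed.

End plane_measure.

(** * The inner product on polynomials *)

Section integral_over_domain.
Variables (R : realType) (Omega : set (R * R)).
Hypotheses (oOmega : open Omega) (bOmega : bounded_set Omega).
Implicit Types f g p : mpoly 2 R.

Lemma polyintD p q : polyint Omega (p + q) = polyint Omega p + polyint Omega q.
Proof.
have mO := open_measurable_plane oOmega.
rewrite -RintegralD//; [|exact: integrable_poly_eval..].
by apply: eq_Rintegral => z _; rewrite poly_evalD.
Qed.

Lemma polyintZ c p : polyint Omega (c *: p) = c * polyint Omega p.
Proof.
have mO := open_measurable_plane oOmega.
rewrite -RintegralZl//; last exact: integrable_poly_eval.
by apply: eq_Rintegral => z _; rewrite poly_evalZ.
Qed.

Lemma polyint_sum (I : Type) (r : seq I) (F : I -> mpoly 2 R) :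
  polyint Omega (\sum_(i <- r) F i) = \sum_(i <- r) polyint Omega (F i).
Proof.
apply: (big_morph (polyint Omega)) => [p q|]; first exact: polyintD.
by rewrite -(scale0r (0 : mpoly 2 R)) polyintZ mul0r.
Qed.

Lemma innerE f g : inner Omega f g = polyint Omega (f * g).
Proof. by apply: eq_Rintegral => z _; rewrite poly_evalM. Qed.

Lemma inner_definite f : Omega !=set0 -> inner Omega f f = 0 -> f = 0.
Proof.
move=> [z Oz] ff0; have [r r0 rO] := open_box oOmega Oz.
apply: (poly_eval_box_eq0 (z := z) r0) => w /rO Ow.
exact: Rintegral_sqr_eq0 ff0 w Ow.
Qed.

(** A combination of degree below [m] is orthogonal to every [b j], hence to
    itself. *)
Lemma orthogonal_basis_leading_free m (b : 'I_m.+1 -> mpoly 2 R) :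
  Omega !=set0 -> (1 <= m)%N -> orthogonal_basis Omega b ->
  forall c : 'I_m.+1 -> R,
    (msize (\sum_j c j *: b j) <= m)%N -> forall j, c j = 0.
Proof.
move=> O0 m1 [bO _ bfree _] c Sm; apply: bfree.
set S := \sum_j _ in Sm *; apply: inner_definite => //.
rewrite innerE {1}/S mulr_suml polyint_sum big1// => j _.
rewrite -scalerAl polyintZ -innerE.
by have [_ ->] := bO j; rewrite ?mulr0// /degree_le prednK.
Qed.

End integral_over_domain.

Theorem theorem4p9 (R : realType) (Omega : set (R * R))
    (P : forall m : nat, 'I_m.+1 -> mpoly 2 R)
    (hOmega : polygon Omega)
    (hP : forall m : nat, (1 <= m)%N -> orthogonal_basis Omega (P m))
    (n : nat) (hn : (2 <= n)%N)
    (p : mpoly 2 R) (hp : msize p = n.+1) :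
  (exists M J : mpoly 2 R, [/\ Mspace P M, degree_le 2 J & p = M + J]) /\
  (exists c : 'I_6 -> R,
     polyint Omega p = \sum_(i < 6) c i * polyint Omega (Q R i)).
Proof.
have [oO _ bO _ Opos] := hOmega.
have O0 : Omega !=set0.
  apply/set0P/negP => /eqP OE; move: Opos.
  by rewrite OE measure0 ltxx.
have Pdeg m j : (1 <= m)%N -> (msize (P m j) <= m.+1)%N.
  by move=> /hP[/(_ j)[]].
have Pspan m f : (1 <= m)%N -> (msize f <= m.+1)%N ->
    exists c : 'I_m.+1 -> R, (msize (f - \sum_j c j *: P m j)%R <= m)%N.
  move=> m1; apply: leading_forms_span => [j|]; first exact: Pdeg.
  exact: (orthogonal_basis_leading_free oO bO O0 m1 (hP m m1)).
have [|q [qdeg Jdeg]] := odd_degree_division Pdeg Pspan (leqnn n) (p := p).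
  by rewrite hp.
set S := \sum_(1 <= k < n.+1) _ in Jdeg.
(* Each term of S pairs P (2 k - 1) j with a polynomial of lower degree. *)
have S0 : polyint Omega S = 0.
  rewrite polyint_sum// big_nat big1// => k /andP[k1 _].
  rewrite polyint_sum// big1// => j _; rewrite mulrC -innerE.
  have k2 : (1 <= 2 * k - 1)%N by lia.
  have [/(_ j)[_ ->]//] := hP _ k2.
  by rewrite /degree_le (_ : (2 * k - 1).-1 = 2 * k - 2)%N//; lia.
have pE : p = S + (p - S) by rewrite addrC subrK.
split.
  exists S, (p - S); split=> //.
  exists n, q, 0; split=> // [k _ j|]; first exact: qdeg.
  by rewrite raddf0 addr0.
have [c Jc] := quadratic_span Jdeg.
exists c; rewrite {1}pE Jc polyintD// S0 add0r polyint_sum//.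
by apply: eq_bigr => i _; rewrite polyintZ.
Qed.
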